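(* For every integer $n\ge 2$, with $m_i=\left\lfloor \log_2\left(\frac{i-1}{4}\right)\right\rfloor$, $$2\cdot\sum_{i=\lceil n/2\rceil+1}^{n}\left(\left\lfloor\frac{i-1}{2}\right\rfloor+\left\lfloor\frac{n-i}{2}\right\rfloor\right)!\cdot\prod_{j=1}^{m_i}(2^{j-1})!\ \le\ a_n .$$
   Context: Places $1,\dots,n$ stand in a row; neighbouring places have distance $1$. At any time at which at least one place is occupied, the distance of an empty place $x$ is $\min|x-y|$ over all occupied places $y$. Persons arrive one after another and each occupies one empty place. Politeness rule: every person except the first (who chooses freely) occupies one of the empty places whose distance is maximal among all empty places at that time. $a_n$ is the number of sequences $(x_1,\dots,x_n)$ (permutations of $\{1,\dots,n\}$, $x_t$ being the place taken by the $t$-th person) in which $n$ persons fill all $n$ places obeying the politeness rule. A product $\prod_{j=1}^{m}$ with $m\le 0$ is empty and equals $1$. *)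

(* Defs.v *)
From mathcomp Require Import all_boot all_order all_algebra perm.
From mathcomp Require Import reals exp.

Set Implicit Arguments.
Unset Strict Implicit.
Unset Printing Implicit Defensive.

Import GRing.Theory Num.Theory.

Local Open Scope ring_scope.

(* The places 1, ..., n are represented by the elements 0, ..., n-1 of 'I_n
   (shifting all labels by one preserves distances), and likewise the persons:
   s : 'S_n stands for the sequence in which person t takes place s t. *)
Section Seating.

Variable n : nat.
Implicit Types (s : 'S_n) (O : {set 'I_n}) (t x y : 'I_n).

Definition place_dist x y : nat := absz ((x : nat)%:Z - (y : nat)%:Z).

(* For O != set0 this is the minimum of |x - y| over y in O, as all distances
   are smaller than the default n; it is not used for O = set0. *)
Definition dist_to O x : nat := \big[Order.min/n]_(y in O) place_dist x y.

(* The places taken just before person t arrives *)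
Definition occupied s t : {set 'I_n} := [set s u | u : 'I_n & (u < t)%N].

Definition polite s : bool :=
  [forall t : 'I_n, (0 < t)%N ==>
    [forall y : 'I_n, (y \notin occupied s t) ==>
       (dist_to (occupied s t) y <= dist_to (occupied s t) (s t))%N]].

End Seating.

Definition num_polite (n : nat) : nat := #|[set s : 'S_n | polite s]|.

Definition log2 (R : realType) (x : R) : R := ln x / ln 2.

Definition m_ (R : realType) (i : nat) : int :=
  Num.floor (log2 ((i%:R - 1) / 4 : R)).

(* The product of F j for 1 <= j <= m, equal to 1 when m <= 0 *)
Definition prod_upto (m : int) (F : nat -> nat) : nat :=
  if m is Posz k then (\prod_(1 <= j < k.+1) F j)%N else 1%N.

(* Main.v *)
Require Import Defs.
From mathcomp Require Import all_boot all_order all_algebra perm.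
From mathcomp Require Import reals exp.
From mathcomp Require Import zify.

Set Implicit Arguments.
Unset Strict Implicit.
Unset Printing Implicit Defensive.

Import Order.TTheory GRing.Theory Num.Theory.

(** Fix the first place [c] and label every place by its distance at the moment
    it is taken in one polite seating: repeatedly occupy the midpoints of the
    intervals, starting from the two stretches between [c] and the ends of the
    row.  Two places with labels [>= d] are at distance [>= d], and every place
    with label [<= d] is within distance [d] of some place with label [> d].
    These two properties make every seating with weakly decreasing labels
    polite, so at least [\prod_d N_d`!] polite seatings start at [c], where
    [N_d] is the number of places labelled [d].
    On an interval of length [l], half of the places have label 1; and halving
    it [k] times yields [2 ^ k] intervals whose lengths are [q] or [q + 1] with
    [q = l %/ 2 ^ k], so their midpoints carry only two labels, one of which
    occurs at least [2 ^ (k - 1)] times.  For different [k] these labels differ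
    as long as [q >= 4]. *)

(** * Recursive midpoint labels on an interval *)

(* Labels of the inner points of the interval [0, l]; meaningful only when
   [l <= fuel] and [0 < x < l]. *)
Fixpoint lab_rec (fuel l x : nat) : nat :=
  if fuel is fuel'.+1 then
    if x == l./2 then l./2
    else if x < l./2 then lab_rec fuel' l./2 x
    else lab_rec fuel' (l - l./2) (x - l./2)
  else 0.

Lemma lab_rec_mid fuel l : lab_rec fuel.+1 l l./2 = l./2.
Proof. by rewrite /= eqxx. Qed.

Lemma lab_rec_left fuel l x : x < l./2 -> lab_rec fuel.+1 l x = lab_rec fuel l./2 x.
Proof. by move=> xh; rewrite /= ltn_eqF // xh. Qed.

Lemma lab_rec_right fuel l x : l./2 < x ->
  lab_rec fuel.+1 l x = lab_rec fuel (l - l./2) (x - l./2).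
Proof. by move=> xh; rewrite /= gtn_eqF // ltnNge ltnW. Qed.

(* Here 0 is an occupied place and [l] is the end of the row, hence itself a place
   to be taken, at distance [l]. *)
Definition lab l x := if x == l then l else lab_rec l l x.

(** A label is half the length, rounded down, of a subinterval of [[0, l]] with midpoint [x], so
    neither end of [[0, l]] is nearer to [x] than that. *)
Lemma lab_rec_le fuel l x : l <= fuel -> 0 < x < l ->
  lab_rec fuel l x <= x /\ lab_rec fuel l x <= l - x.
Proof.
elim: fuel l x => [|f IH] l x lf xl; first by lia.
rewrite /=; case: eqP => [->|ne]; first by lia.
case: ltnP => xh.
  have := IH l./2 x ltac:(lia) ltac:(lia); lia.
have := IH (l - l./2) (x - l./2) ltac:(lia) ltac:(lia); lia.
Qed.

(** Once a midpoint separates the two points or equals one of them, [lab_rec_le] bounds a label by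
    the distance to that midpoint. *)
Lemma lab_rec_sep fuel l x y : l <= fuel -> 0 < x -> x < y -> y < l ->
  minn (lab_rec fuel l x) (lab_rec fuel l y) <= y - x.
Proof.
move=> lf x0 xy yl; rewrite geq_min.
elim: fuel l x y lf x0 xy yl => [|f IH] l x y lf x0 xy yl; first by lia.
rewrite /=.
case: (eqVneq x l./2) => [xh|xh]; case: (eqVneq y l./2) => [yh|yh].
- by lia.
- rewrite ltnNge (_ : l./2 <= y) /=; last by lia.
  have := @lab_rec_le f (l - l./2) (y - l./2) ltac:(lia) ltac:(lia); lia.
- rewrite (_ : x < l./2); last by lia.
  have := @lab_rec_le f l./2 x ltac:(lia) ltac:(lia); lia.
- case: (ltnP x l./2) => xh'; case: (ltnP y l./2) => yh'.
  + by apply: IH; lia.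
  + have := @lab_rec_le f l./2 x ltac:(lia) ltac:(lia); lia.
  + by lia.
  + rewrite (_ : y - x = (y - l./2) - (x - l./2)); last by lia.
    by apply: IH; lia.
Qed.

Lemma lab_rec_cover fuel l x d : l <= fuel -> 0 < x < l -> lab_rec fuel l x <= d ->
  [\/ x <= d, l - x <= d |
    exists z, [/\ 0 < z < l, d < lab_rec fuel l z, x - z <= d & z - x <= d]].
Proof.
elim: fuel l x => [|f IH] l x lf xl; first by lia.
(* The induction hypothesis may lead to the new end [l./2] instead of a point [z]. If [d < l./2],
   this end serves as [z]; otherwise [x] is within [d] of an outer end. *)
have mid : d < l./2 -> x - l./2 <= d -> l./2 - x <= d ->
  [\/ x <= d, l - x <= d |
    exists z, [/\ 0 < z < l, d < lab_rec f.+1 l z, x - z <= d & z - x <= d]].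
  move=> dh h1 h2; apply: Or33; exists l./2; split=> //; first by lia.
  by rewrite lab_rec_mid.
rewrite [lab_rec _ _ _]/=; case: eqP => [->|ne] ld; first by apply: Or31.
move: ld; case: ltnP => xh ld.
  have [|||xd|xd|[z [zl dz h1 h2]]] := IH l./2 x; try (by []); try lia.
  - by apply: Or31.
  - case: (ltnP d l./2) => dh; last by apply: Or31; lia.
    by apply: mid => //; lia.
  - apply: Or33; exists z.
    have [zh zl'] : z < l./2 /\ 0 < z < l by lia.
    by rewrite lab_rec_left.
have [|||xd|xd|[z [zl dz h1 h2]]] := IH (l - l./2) (x - l./2); try (by []); try lia.
- case: (ltnP d l./2) => dh; last by apply: Or32; lia.
  by apply: mid => //; lia.
- by apply: Or32; lia.
- apply: Or33; exists (z + l./2).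
  have [zh [zl' [h1' h2']]] : l./2 < z + l./2 /\ 0 < z + l./2 < l /\
    x - (z + l./2) <= d /\ z + l./2 - x <= d by lia.
  by rewrite lab_rec_right // addnK.
Qed.

Lemma lab_le l x : 0 < x <= l -> lab l x <= x.
Proof.
rewrite /lab; case: eqP => [->|ne] xl //.
by have := @lab_rec_le l l x ltac:(lia) ltac:(lia); lia.
Qed.

Lemma lab_sep l x y : 0 < x -> x < y -> y <= l -> minn (lab l x) (lab l y) <= y - x.
Proof.
move=> x0 xy yl; rewrite /lab (_ : x == l = false); last by lia.
case: eqP => [E|ne]; last by apply: lab_rec_sep; lia.
have := @lab_rec_le l l x ltac:(lia) ltac:(lia); lia.
Qed.

Lemma lab_cover l x d : 0 < x <= l -> lab l x <= d ->
  x <= d \/ exists z, [/\ 0 < z <= l, d < lab l z, x - z <= d & z - x <= d].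
Proof.
rewrite {1}/lab; case: eqP => [->|ne] xl ld; first by left.
case: (@lab_rec_cover l l x d) => //; first by lia.
- by left.
(* If [d < x] then [d < l], so the end [l], labelled [l], serves as [z]. *)
- move=> xd; case: (leqP x d) => dx; first by left.
  by right; exists l; rewrite /lab eqxx; split; lia.
- move=> [z [zl dz h1 h2]]; right; exists z; split=> //; first by lia.
  by rewrite /lab (_ : z == l = false) //; lia.
Qed.

(** * How often a label occurs on an interval *)

Definition lab_count fuel l d := \sum_(1 <= x < l) (lab_rec fuel l x == d).

Lemma lab_count_rec fuel l d : 1 < l ->
  lab_count fuel.+1 l d =
  (l./2 == d) + (lab_count fuel l./2 d + lab_count fuel (l - l./2) d).
Proof.
move=> l1; rewrite /lab_count (@big_cat_nat _ _ _ l./2); try lia.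
rewrite addnCA; congr (_ + _).
  rewrite !big_seq; apply: eq_bigr => x; rewrite mem_index_iota => xl.
  have xh : x < l./2 by lia.
  by rewrite lab_rec_left.
rewrite big_ltn; last by lia.
rewrite lab_rec_mid; congr (_ + _).
rewrite -{1}add1n big_addn big_seq [RHS]big_seq.
apply: eq_bigr => x; rewrite mem_index_iota => xl.
have xh : l./2 < x + l./2 by lia.
by rewrite lab_rec_right // addnK.
Qed.

Lemma lab_count1 fuel l : l <= fuel -> l./2 <= lab_count fuel l 1.
Proof.
move=> lf; case: (leqP l 1) => l1; first by rewrite (_ : l./2 = 0); lia.
(* Rounding up fails for [l = 1] but survives halving when both halves have length at least 2;
   rounding down would lose one at a split into two odd halves. *)
suff: uphalf l <= lab_count fuel l 1 by lia.
elim: fuel l lf l1 => [|f IH] l lf l1; first by lia.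
rewrite lab_count_rec //.
case: (ltnP l 4) => l4.
  have [E|E] : l = 2 \/ l = 3 by lia.
    by rewrite E.
  rewrite E in lf *; have := IH 2 ltac:(lia) ltac:(lia); rewrite -[3 - 3./2]/2; lia.
have := IH l./2 ltac:(lia) ltac:(lia).
have := IH (l - l./2) ltac:(lia) ltac:(lia).
lia.
Qed.

(** Halving preserves the bounds on [l], with [k] lowered by one, since they are even for positive
    [k]. At [k = 0] the length is [q] or [q.+1], with midpoint [q./2] or [uphalf q]. *)
Lemma lab_count_level fuel l k q : l <= fuel -> 1 < q ->
  2 ^ k * q <= l -> l <= 2 ^ k * q.+1 ->
  2 ^ k <= lab_count fuel l q./2 + lab_count fuel l (uphalf q).
Proof.
move=> lf q1; elim: k fuel l lf => [|k IH] [|f] l lf h1 h2; try lia.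
- rewrite expn0 !mul1n in h1 h2 *; rewrite !lab_count_rec; lia.
- rewrite expnS in h1 h2 *.
  have k0 : 0 < 2 ^ k by rewrite expn_gt0.
  have k1 : 1 < 2 ^ k * q by nia.
  rewrite !lab_count_rec; try lia.
  have := IH f l./2 ltac:(lia) ltac:(lia) ltac:(lia).
  have := IH f (l - l./2) ltac:(lia) ltac:(lia) ltac:(lia).
  lia.
Qed.

(** * Products of factorials of label multiplicities *)

Lemma leq_prod_nat_term (F : nat -> nat) a b d :
  (forall i, 0 < F i) -> a <= d < b -> F d <= \prod_(a <= i < b) F i.
Proof.
move=> F0 dab; rewrite (bigD1_seq d) ?mem_index_iota ?iota_uniq //=.
by rewrite leq_pmulr // prodn_cond_gt0.
Qed.

(* The label found at level [k] lies in [q./2 <= d < q] for [q = l %/ 2 ^ k], so the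
   levels use pairwise disjoint ranges of labels. *)
Lemma factorial_levels (N : nat -> nat) l k D :
  (forall d, lab_count l l d <= N d) -> l < D -> 2 ^ k.+1 * 2 <= l ->
  \prod_(1 <= j < k.+1) (2 ^ (j - 1))`! <= \prod_(l %/ 2 ^ k.+1 <= d < D) (N d)`!.
Proof.
move=> Nl lD; elim: k => [|k IH] hl.
  by rewrite big_geq // prodn_gt0 // => i; apply: fact_gt0.
set q := l %/ 2 ^ k.+1.
have e0 : 0 < 2 ^ k.+1 by rewrite expn_gt0.
have hq : 4 <= q.
  rewrite leq_divRL //; move: hl; rewrite (expnS 2 k.+1); lia.
have -> : l %/ 2 ^ k.+2 = q./2 by rewrite expnSr divnMA divn2.
rewrite big_nat_recr //= mulnC.
have qD : q <= D by apply: leq_trans (leq_div _ _) _; lia.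
rewrite [leqRHS](@big_cat_nat _ _ _ q) //=; last by lia.
apply: leq_mul; last first.
  by apply: IH; move: hl; rewrite (expnS 2 k.+1); lia.
have lev := @lab_count_level l l k.+1 q (leqnn l) ltac:(lia).
have {lev} lev : 2 ^ k.+1 <= lab_count l l q./2 + lab_count l l (uphalf q).
  by apply: lev; rewrite mulnC ?leq_divM //; apply/ltnW/ltn_ceil.
rewrite subn1 /=.
(* Pigeonhole: two labels share [2 ^ k.+1] points. Both lie below [q] because [4 <= q]. *)
have [d hd Nd] : exists2 d, q./2 <= d < q & 2 ^ k <= N d.
  have N1 := Nl q./2; have N2 := Nl (uphalf q); rewrite expnS in lev.
  case: (leqP (2 ^ k) (N q./2)) => h; first by exists q./2; lia.
  by exists (uphalf q); lia.
apply: leq_trans (leq_prod_nat_term (F := fun d => (N d)`!) _ hd).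
  by rewrite leq_fact.
by move=> i; apply: fact_gt0.
Qed.

(** The factorial of [K] comes from label 1, the other factors from labels at least 2: the last
    quotient [l %/ 2 ^ k.+1] is still at least 2. *)
Lemma factorial_bound (N : nat -> nat) l K k D :
  (forall d, lab_count l l d <= N d) -> K <= N 1 -> l < D -> 1 < D ->
  (0 < k -> 2 ^ k.+2 <= l) ->
  K`! * \prod_(1 <= j < k.+1) (2 ^ (j - 1))`! <= \prod_(0 <= d < D) (N d)`!.
Proof.
move=> Nl KN lD D1 kl.
have F0 i : 0 < (N i)`! by apply: fact_gt0.
rewrite [leqRHS](@big_cat_nat _ _ _ 2) //=; apply: leq_mul.
  apply: leq_trans (leq_prod_nat_term (F := fun d => (N d)`!) (d := 1) F0 _) => //.
  by rewrite leq_fact.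
case: k kl => [|k] kl; first by rewrite big_geq // prodn_gt0.
have {}kl := kl isT.
have e0 : 0 < 2 ^ k.+2 by rewrite expn_gt0.
have hl : 2 ^ k.+2 * 2 <= l by rewrite -expnSr.
apply: leq_trans (factorial_levels Nl lD hl) _.
have q2 : 2 <= l %/ 2 ^ k.+2 by rewrite leq_divRL // mulnC.
rewrite [leqRHS](@big_cat_nat _ _ _ (l %/ 2 ^ k.+2)) //=.
  by rewrite leq_pmull // prodn_gt0.
by apply: leq_trans (leq_div _ _) _; lia.
Qed.

(** * Seatings with weakly decreasing labels *)

Section Counting.
Variables (n : nat) (f : 'I_n -> nat).

Definition label_antitone (s : 'S_n) :=
  [forall u : 'I_n, forall v : 'I_n, (u <= v)%N ==> (f (s v) <= f (s u))].

Lemma label_antitoneP (s : 'S_n) :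
  reflect (forall u v : 'I_n, u <= v -> f (s v) <= f (s u)) (label_antitone s).
Proof.
apply: (iffP forallP) => [h u v uv | h u].
  by have /forallP/(_ v)/implyP := h u; apply.
by apply/forallP => v; apply/implyP/h.
Qed.

Lemma label_antitone_exists : exists s, label_antitone s.
Proof.
have [n0|n0] := posnP n.
  by exists 1%g; apply/forallP => u; have := leq_ltn_trans (leq0n u) (ltn_ord u); rewrite [X in _ < X]n0.
pose x0 := Ordinal n0.
pose r := sort (fun x y => f y <= f x) (enum 'I_n).
have sr : size r = n by rewrite size_sort size_enum_ord.
have r_inj : injective (fun i : 'I_n => nth x0 r i).
  move=> i j /eqP; rewrite nth_uniq ?sr ?ltn_ord //; last first.
    by rewrite sort_uniq enum_uniq.
  by move/eqP/val_inj.
exists (perm r_inj); apply/label_antitoneP => u v uv.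
rewrite !permE.
apply: (@sorted_leq_nth _ (fun x y => f y <= f x)) => //.
- by move=> x y z h1 h2; apply: leq_trans h1.
- by apply: sort_sorted => x y; apply: leq_total.
- by rewrite inE sr.
- by rewrite inE sr.
Qed.

(** Once [D] exceeds all labels, this is the Young subgroup of the label classes; the bound [D] lets
    it be built one class at a time. *)
Definition label_stab D :=
  [set s : 'S_n | [forall x, (f (s x) == f x) && ((D <= f x) ==> (s x == x))]].

Lemma label_stabP D (s : 'S_n) :
  reflect (forall x, f (s x) = f x /\ (D <= f x -> s x = x)) (s \in label_stab D).
Proof.
rewrite inE; apply: (iffP forallP) => h x.
  by have /andP[/eqP-> /implyP h'] := h x; split=> // /h'/eqP.
have [-> h'] := h x; rewrite eqxx /=; apply/implyP => /h'->; exact: eqxx.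
Qed.

(** Multiplying [label_stab D] by [Sym A], with [A] the class of label [D], is injective: on [A] the
    product acts as its second factor, which is the identity elsewhere. *)
Lemma card_label_stab D :
  \prod_(0 <= d < D) #|[set x | f x == d]|`! <= #|label_stab D|.
Proof.
elim: D => [|D IH].
  rewrite big_geq //; apply/card_gt0P; exists 1%g.
  by apply/label_stabP => x; rewrite perm1.
rewrite big_nat_recr //=; set A := [set x | f x == D].
apply: leq_trans (leq_mul IH (leqnn _)) _.
have <- : #|Sym A| = #|A|`! by rewrite -card_perm; apply: eq_card => s; rewrite inE.
rewrite -cardsX.
pose h (p : 'S_n * 'S_n) := (p.1 * p.2)%g.
have h_inj : {in setX (label_stab D) (Sym A) &, injective h}.
  case=> [s t] [s' t']; rewrite !in_setX /= => /andP[/label_stabP hs]; rewrite inE => ht.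
  case/andP=> /label_stabP hs'; rewrite inE => ht' E.
  have tt' : t = t'.
    apply/permP => x; case: (boolP (x \in A)) => xA.
      have Dx : D <= f x by move: xA; rewrite inE => /eqP->.
      by have /permP/(_ x) := E; rewrite !permM (proj2 (hs x)) // (proj2 (hs' x)).
    by rewrite (out_perm ht) // (out_perm ht').
  by move: E; rewrite /h /= tt' => /mulIg ->.
rewrite -(card_in_imset h_inj); apply/subset_leq_card/subsetP => _ /imsetP[[s t] + ->].
rewrite in_setX /= => /andP[/label_stabP hs]; rewrite inE => ht.
apply/label_stabP => x; rewrite permM.
have ft y : f (t y) = f y.
  case: (boolP (y \in A)) => yA; last by rewrite (out_perm ht).
  have : t y \in A by rewrite perm_closed.
  by move: yA; rewrite !inE => /eqP-> /eqP->.
split; first by rewrite ft (proj1 (hs x)).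
move=> Dx; rewrite (proj2 (hs x)); last exact: ltnW.
by rewrite (out_perm ht) // inE; case: ltngtP Dx.
Qed.

(** One such seating followed by any label-preserving permutation of the places is another. *)
Lemma card_label_antitone D :
  \prod_(0 <= d < D) #|[set x | f x == d]|`! <= #|[set s | label_antitone s]|.
Proof.
have [s0 /label_antitoneP hs0] := label_antitone_exists.
apply: leq_trans (card_label_stab D) _.
have h_inj : {in label_stab D &, injective (fun s => s0 * s)%g}.
  by move=> s t _ _; apply: mulgI.
rewrite -(card_in_imset h_inj); apply/subset_leq_card/subsetP => _ /imsetP[s hs ->].
rewrite inE; apply/label_antitoneP => u v uv; rewrite !permM.
by move/label_stabP: hs => hs; rewrite (proj1 (hs _)) (proj1 (hs (s0 u))) hs0.
Qed.

(** Earlier places have labels at least [f (s t)], so by separation [s t] is at least that far from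
    them. An empty [y] has label at most [f (s t)], so covering gives a place within [f (s t)] whose
    larger label means it is already taken. *)
Lemma label_antitone_polite (c : 'I_n) (s : 'S_n) :
  (forall y, y != c -> f y < f c) ->
  (forall x y, x != y -> minn (f x) (f y) <= place_dist x y) ->
  (forall y d, f y <= d -> d < f c -> exists2 z, d < f z & place_dist y z <= d) ->
  label_antitone s -> polite s /\ (forall t : 'I_n, t = 0 :> nat -> s t = c).
Proof.
move=> top sep cover /label_antitoneP anti.
have s0 (t : 'I_n) : t = 0 :> nat -> s t = c.
  move=> t0; apply/eqP; apply/negPn/negP => /top.
  rewrite ltnNge -{1}(permKV s c) => /negP; apply; apply: anti.
  by rewrite t0.
split=> //; apply/forallP => t; apply/implyP => t0.
have n0 : 0 < n by apply: leq_ltn_trans (ltn_ord t).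
have sc : s t != c.
  by rewrite -(s0 (Ordinal n0) erefl) (inj_eq perm_inj) -val_eqE /= -lt0n.
apply/forallP => y; apply/implyP => yO.
apply: (@leq_trans (f (s t))).
  have [|z dz yz] := cover y (f (s t)) _ (top _ sc).
    rewrite -(permKV s y); apply: anti; rewrite leqNgt; apply/negP => h.
    by move/imsetP: yO; apply; exists ((s^-1)%g y); rewrite ?inE ?permKV.
  apply: leq_trans yz; rewrite /dist_to -leEnat.
  apply: bigmin_le_cond.
  apply/imsetP; exists ((s^-1)%g z); rewrite ?permKV ?inE //.
  rewrite ltnNge; apply/negP => /anti; rewrite permKV leqNgt; exact/negP/negPn.
(* The default [n] of the minimum must be at least the label too. *)
rewrite /dist_to -leEnat; apply/bigmin_geP; split.
  have := sep _ _ sc; rewrite (minn_idPl (ltnW (top _ sc))) leEnat => h.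
  apply: leq_trans h _; rewrite /place_dist.
  by have := ltn_ord (s t); have := ltn_ord c; lia.
move=> _ /imsetP[u + ->]; rewrite inE => ut.
have := sep (s t) (s u); rewrite leEnat (minn_idPl _); last by apply/anti/ltnW.
by apply; rewrite (inj_eq perm_inj) -val_eqE /= neq_ltn ut orbT.
Qed.

End Counting.

(** * Labelling the row around the first place *)

(** The value [n] at [c] exceeds every distance in the row; each side is labelled outwards from [c].
    The argument is a [nat] so that labels can be counted over index ranges. *)
Definition seat_label n (c : 'I_n) (y : nat) : nat :=
  if y == c then n else if y < c then lab c (c - y) else lab (n.-1 - c) (y - c).

Section SeatLabel.
Variables (n : nat) (c : 'I_n).
Let f := seat_label c.

Lemma seat_labelC : f c = n.
Proof. by rewrite /f /seat_label eqxx. Qed.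

Lemma seat_labelL y : y < c -> f y = lab c (c - y).
Proof. by move=> yc; rewrite /f /seat_label ltn_eqF // yc. Qed.

Lemma seat_labelR y : c < y -> f y = lab (n.-1 - c) (y - c).
Proof. by move=> yc; rewrite /f /seat_label gtn_eqF // ltnNge ltnW. Qed.

Lemma seat_label_le (y : 'I_n) : y != c -> f y <= place_dist y c.
Proof.
rewrite -val_eqE /= /place_dist neq_ltn => /orP[] yc; have yn := ltn_ord y.
  rewrite seat_labelL //; have := @lab_le c (c - y) ltac:(lia); lia.
rewrite seat_labelR //; have := @lab_le (n.-1 - c) (y - c) ltac:(lia); lia.
Qed.

Lemma seat_label_lt (y : 'I_n) : y != c -> f y < f c.
Proof.
move=> yc; apply: leq_ltn_trans (seat_label_le yc) _; rewrite seat_labelC /place_dist.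
by have := ltn_ord y; have := ltn_ord c; lia.
Qed.

Lemma seat_label_sep (x y : 'I_n) : x != y -> minn (f x) (f y) <= place_dist x y.
Proof.
have sym : place_dist x y = place_dist y x by rewrite /place_dist; lia.
wlog xy : x y sym / x < y.
  move=> W ne; have : (x < y) || (y < x) by rewrite -neq_ltn.
  case/orP => xy; first by apply: W.
  by rewrite minnC sym; apply: W => //; rewrite eq_sym.
move=> _; have yn := ltn_ord y.
case: (eqVneq x c) => [E|xc].
  rewrite geq_min orbC sym E seat_label_le //.
  by rewrite -E -val_eqE /= gtn_eqF.
case: (eqVneq y c) => [->|yc]; first by rewrite geq_min seat_label_le.
have xc' : x <> c :> nat by move/val_inj/eqP; apply/negP.
have yc' : y <> c :> nat by move/val_inj/eqP; apply/negP.
case: (ltnP x c) => xlc; last first.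
  rewrite !seat_labelR; try lia.
  have := @lab_sep (n.-1 - c) (x - c) (y - c) ltac:(lia) ltac:(lia) ltac:(lia).
  by rewrite /place_dist; lia.
case: (ltnP y c) => ylc.
  rewrite !seat_labelL; try lia.
  have := @lab_sep c (c - y) (c - x) ltac:(lia) ltac:(lia) ltac:(lia).
  by rewrite /place_dist minnC; lia.
(* On opposite sides of [c], [x] is nearer to [c] than to [y]. *)
by have := seat_label_le xc; rewrite geq_min /place_dist; lia.
Qed.

Lemma seat_label_cover (y : 'I_n) d : f y <= d -> d < f c ->
  exists2 z : 'I_n, d < f z & place_dist y z <= d.
Proof.
move=> yd dc; have yn := ltn_ord y; have cn := ltn_ord c.
(* When [lab_cover] only yields closeness to the origin of a side, [c] itself is the required
   place. *)
have center : `|y - c| <= d -> exists2 z : 'I_n, d < f z & place_dist y z <= d.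
  by exists c.
case: (ltngtP y c) => yc; last by apply: center; lia.
  rewrite seat_labelL // in yd.
  have [||h|[z [zl dz h1 h2]]] := @lab_cover c (c - y) d; try (by []); try lia.
    by apply: center; lia.
  have zn : c - z < n by lia.
  exists (Ordinal zn); last by rewrite /place_dist /=; lia.
  by rewrite seat_labelL /= ?subKn //; lia.
rewrite seat_labelR // in yd.
have [||h|[z [zl dz h1 h2]]] := @lab_cover (n.-1 - c) (y - c) d; try (by []); try lia.
  by apply: center; lia.
have zn : c + z < n by lia.
exists (Ordinal zn); last by rewrite /place_dist /=; lia.
by rewrite seat_labelR /= ?addKn //; lia.
Qed.

Lemma sum_lab l d : lab_count l l d <= \sum_(1 <= x < l.+1) (lab l x == d).
Proof.
case: l => [|l]; first by rewrite /lab_count !big_geq.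
rewrite big_nat_recr //= /lab_count; apply: leq_trans (leq_addr _ _).
rewrite big_seq [leqRHS]big_seq; apply: leq_sum => x; rewrite mem_index_iota => xl.
by rewrite /lab (_ : (x == l.+1) = false) //; lia.
Qed.

Lemma seat_label_count d :
  lab_count c c d + lab_count (n.-1 - c) (n.-1 - c) d <= #|[set y : 'I_n | f y == d]|.
Proof.
have cn := ltn_ord c.
have -> : #|[set y : 'I_n | f y == d]| = \sum_(0 <= y < n) (f y == d).
  by rewrite -sum1dep_card big_mkcond big_mkord; apply: eq_bigr => y _; case: eqP.
rewrite (@big_cat_nat _ _ _ c) //=; last by lia.
apply: leq_add; apply: leq_trans (sum_lab _ _) _.
  (* The left side is read outwards from [c], hence the reversal. *)
  rewrite [leqRHS]big_nat_rev /= big_add1 /=.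
  rewrite big_seq [leqRHS]big_seq; apply: leq_sum => x; rewrite mem_index_iota => xl.
  by rewrite seat_labelL; last lia; rewrite (_ : c - (0 + c - x.+1) = x.+1) //; lia.
rewrite [leqRHS]big_ltn //; apply: leq_trans (leq_addl _ _).
rewrite -(add1n c) big_addn (_ : n - c = (n.-1 - c).+1); last by lia.
rewrite big_seq [leqRHS]big_seq; apply: leq_sum => x; rewrite mem_index_iota => xl.
by rewrite seat_labelR ?addnK //; lia.
Qed.

(** Label 1 is counted on both sides of [c], the halving levels only on the side of length [l]. *)
Lemma card_polite_from k l : 1 < n -> (l == c :> nat) || (l == n.-1 - c) ->
  (0 < k -> 2 ^ k.+2 <= l) ->
  (c./2 + (n.-1 - c)./2)`! * \prod_(1 <= j < k.+1) (2 ^ (j - 1))`! <=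
  #|[set s : 'S_n | polite s & [forall t : 'I_n, (t == 0 :> nat) ==> (s t == c)]]|.
Proof.
move=> n1 hl hk; have cn := ltn_ord c.
pose N d := #|[set y : 'I_n | f y == d]|.
apply: (@leq_trans (\prod_(0 <= d < n) (N d)`!)).
  apply: (@factorial_bound N l) => //.
  - move=> d; have := seat_label_count d; rewrite -/(N d).
    by case/orP: hl => /eqP->; lia.
  - have := seat_label_count 1; rewrite -/(N 1).
    have := @lab_count1 c c (leqnn _).
    have := @lab_count1 (n.-1 - c) (n.-1 - c) (leqnn _); lia.
  - by lia.
apply: leq_trans (card_label_antitone (fun y : 'I_n => f y) n) _.
apply/subset_leq_card/subsetP => s; rewrite !inE => hs.
have [-> st] := label_antitone_polite seat_label_lt seat_label_sep seat_label_cover hs.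
by apply/forallP => t; apply/implyP => /eqP/st->.
Qed.

End SeatLabel.

(** * Summation over the first place *)

Lemma num_politeE n : 0 < n ->
  num_polite n = \sum_(c < n)
  #|[set s : 'S_n | polite s & [forall t : 'I_n, (t == 0 :> nat) ==> (s t == c)]]|.
Proof.
case: n => // n _; rewrite /num_polite -sum1_card.
rewrite (partition_big (fun s : 'S_n.+1 => s ord0) predT) //=.
apply: eq_bigr => c _; rewrite sum1dep_card; apply: eq_card => s; rewrite !inE.
congr (_ && _); apply/idP/forallP => [h t|/(_ ord0)//].
by apply/implyP => /eqP t0; rewrite (_ : t = ord0) //; apply: val_inj.
Qed.

Local Open Scope ring_scope.

(** Clearing the logarithm turns the divisor 4 into two more factors of 2. *)
Lemma m_ge (R : realType) i k : (1 < i)%N -> m_ R i = k%:Z -> (2 ^ k.+2 <= i - 1)%N.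
Proof.
move=> i1 mk.
have i0 : 0 < (i%:R - 1) / 4 :> R.
  by rewrite divr_gt0 // subr_gt0 ltr1n.
have l2 : 0 < ln 2 :> R by rewrite ln_gt0 // ltr1n.
have : (k%:Z)%:~R <= log2 ((i%:R - 1) / 4 : R) by rewrite -mk; apply: floor_le.
rewrite /log2 ler_pdivlMr // -[(k%:Z)%:~R]/(k%:R) mulr_natl -lnXn //.
rewrite ler_ln ?posrE ?exprn_gt0 // ler_pdivlMr //.
rewrite -(natrB _ (ltnW i1)) -natrX -natrM ler_nat !expnS; lia.
Qed.

Local Close Scope ring_scope.

Theorem mainTheorem2 (R : realType) (n : nat) (hn : (2 <= n)%N) :
  (2 * \sum_((uphalf n).+1 <= i < n.+1)
         (((i - 1) %/ 2 + (n - i) %/ 2)`! *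
          prod_upto (m_ R i) (fun j => (2 ^ (j - 1))`!))
   <= num_polite n)%N.
Proof.
rewrite num_politeE; last by lia.
rewrite big_add1 /= big_geq_mkord mul2n -addnn.
(* With [c = i - 1], one copy of the sum is matched with the first places [c >= uphalf n], the other
   with their mirror images; for odd [n] the middle place is dropped. *)
rewrite [leqRHS](bigID (fun c : 'I_n => uphalf n <= c)) /=.
rewrite [X in _ <= _ + X](reindex_inj rev_ord_inj) /=.
have bound (c d : 'I_n) : uphalf n <= c -> (d == c) || (d == rev_ord c) ->
  ((c.+1 - 1) %/ 2 + (n - c.+1) %/ 2)`! *
    prod_upto (m_ R c.+1) (fun j => (2 ^ (j - 1))`!) <=
  #|[set s : 'S_n | polite s & [forall t : 'I_n, (t == 0 :> nat) ==> (s t == d)]]|.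
  move=> hc hd; have cn := ltn_ord c.
  (* In both cases the longer side of [d] has length [c], which is the [i - 1] of [m_]. *)
  have hl : (c == d :> nat) || (c == n.-1 - d :> nat).
    by case/orP: hd => /eqP-> /=; lia.
  have -> : (c.+1 - 1) %/ 2 + (n - c.+1) %/ 2 = d./2 + (n.-1 - d)./2.
    by case/orP: hd => /eqP-> /=; rewrite !divn2; lia.
  case mk : (m_ R c.+1) => [k|k] /=.
    apply: card_polite_from hl _ => // _.
    have := m_ge _ mk; rewrite subn1; apply; lia.
  (* A negative [m_] is treated as [k = 0], where the product is also empty. *)
  by have := @card_polite_from n d 0 c hn hl; rewrite [X in _ * X]big_geq //; apply.
apply: leq_add; first by apply: leq_sum => c hc; apply: bound; rewrite ?eqxx.
rewrite [leqRHS]big_mkcond [leqLHS]big_mkcond; apply: leq_sum => c _ /=.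
case: ifP => // hc; rewrite ifT; last by have := ltn_ord c; lia.
by apply: bound; rewrite ?eqxx ?orbT.
Qed.
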